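(* Assume the network graph is connected and that $\sum_{k=1}^N R_{u,k}$ is positive-definite (the individual $R_{u,k}$ being positive-semidefinite and possibly singular). Then there exists $\bar\eta$ such that for every $\eta>\bar\eta$ the matrix $\mathcal{F}'=\mathcal{B}'^{T}\otimes_b\mathcal{B}'^{T}$ is stable for small step-sizes; that is, for every $\eta>\bar\eta$ there is $\bar\mu>0$ (depending on $\eta$) such that $\rho(\mathcal{F}')<1$ for all $0<\mu<\bar\mu$, where $\rho$ denotes the spectral radius.
   Context: Graph: $G$ is an undirected graph with nodes $1,\dots,N$ and $E$ edges (self-loops excluded). Its incidence matrix $C\in\mathbb{R}^{E\times N}$ has, in the row of edge $e$, entry $+1$ at the lower-indexed endpoint, $-1$ at the higher-indexed endpoint, and $0$ elsewhere. The Laplacian is $L=C^{T}C$. When $G$ is connected, $C$ has rank $N-1$. Fix a singular value decomposition $C=USV^{T}$ with $U\in\mathbb{R}^{E\times E}$, $V\in\mathbb{R}^{N\times N}$ orthogonal, $V=[\,V_2\ \ \tfrac{1}{\sqrt N}\mathbf 1_N]$, and $S\in\mathbb{R}^{E\times N}$ whose upper-left $(N-1)\times(N-1)$ block $S_2$ is diagonal with the nonzero singular values of $C$, all other entries of $S$ being zero. Put $\mathcal{S}_2=S_2\otimes I_M$, $\mathcal{V}_2=V_2\otimes I_M$, $\mathcal{V}_0=\tfrac{1}{\sqrt N}\mathbf 1_N\otimes I_M$. Data: for each agent $k=1,\dots,N$, $R_{u,k}\in\mathbb{R}^{M\times M}$ is a symmetric positive-semidefinite (regressor covariance) matrix, and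 $\mathcal{H}=\mathrm{blockdiag}\{R_{u,1},\dots,R_{u,N}\}$. The parameter $\eta\ge 0$ is the regularization parameter and $\mu>0$ is the step-size. The matrix $\mathcal{B}'=I_{(2N-1)M}-\mu\mathcal{R}'$ is defined by $$\mathcal{R}'=\begin{bmatrix}\mathcal{V}_2^{T}\mathcal{H}\mathcal{V}_2+\eta\,\mathcal{S}_2^{T}\mathcal{S}_2 & \mathcal{V}_2^{T}\mathcal{H}\mathcal{V}_0 & \mathcal{S}_2^{T}\\ \mathcal{V}_0^{T}\mathcal{H}\mathcal{V}_2 & \frac1N\sum_{k=1}^N R_{u,k} & 0\\ -\mathcal{S}_2 & 0 & 0\end{bmatrix}\in\mathbb{R}^{(2N-1)M\times(2N-1)M}.$$ $\otimes_b$ is the Tracy-Singh block Kronecker product with respect to the partition into $M\times M$ blocks: if $A=[A_{ij}]$ and $B=[B_{kl}]$ with $M\times M$ blocks, then $A\otimes_b B$ is the block matrix whose $(i,j)$ block is the block matrix $[A_{ij}\otimes B_{kl}]_{k,l}$, with $\otimes$ the usual Kronecker product. *)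

(* Defs.v *)
From mathcomp Require Export all_boot all_order all_algebra.
From mathcomp Require Export classical_sets reals.
From mathcomp Require Export complex mxtens.

Set Implicit Arguments.
Unset Strict Implicit.
Unset Printing Implicit Defensive.

Import Order.TTheory GRing.Theory Num.Theory.
Local Open Scope ring_scope.

(** ** Matrices *)

Definition posSemidefMx (R : realType) m (A : 'M[R]_m) : Prop :=
  A^T = A /\ forall x : 'cV[R]_m, 0 <= (x^T *m A *m x) 0 0.

Definition posDefMx (R : realType) m (A : 'M[R]_m) : Prop :=
  A^T = A /\ forall x : 'cV[R]_m, x != 0 -> 0 < (x^T *m A *m x) 0 0.

Definition orthogonalMx (R : realType) m (A : 'M[R]_m) : Prop :=
  A^T *m A = 1%:M /\ A *m A^T = 1%:M.

(* For m > 0 the set is finite and nonempty, so the supremum is a maximum. *)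
Definition spectralRadius (R : realType) m (A : 'M[R]_m) : R :=
  sup [set r : R | exists2 z : R[i],
         eigenvalue (map_mx (real_complex R) A) z & r = Normc.normc z]%classic.

(* [*t] is the Kronecker product of mxtens; matrices of size \sum_(i < p) M
   carry their partition into p x p blocks of size M x M. *)
Definition tracySingh (R : realType) M p q
    (A : 'M[R]_(\sum_(i < p) M)) (B : 'M[R]_(\sum_(k < q) M)) :
    'M[R]_(\sum_(i < p) \sum_(k < q) (M * M)) :=
  \mxblock_(i < p, j < p) \mxblock_(k < q, l < q)
    (submxblock A i j *t submxblock B k l).

(** ** Graphs

   An undirected graph without self-loops on N nodes is a symmetric irreflexive
   relation on 'I_N; nodes are numbered from 0. *)

Definition connectedGraph N (adj : rel 'I_N) : Prop :=
  forall i j : 'I_N, connect adj i j.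

Definition edgeSet N (adj : rel 'I_N) : {set 'I_N * 'I_N} :=
  [set ij : 'I_N * 'I_N | (ij.1 < ij.2)%N && adj ij.1 ij.2].

(* The edges are numbered by [enum_val]; another numbering only permutes the
   rows of C, hence those of the factor U of its singular value decomposition. *)
Definition incidence (R : realType) N (adj : rel 'I_N) :
    'M[R]_(#|edgeSet adj|, N) :=
  \matrix_(e, k) if k == (enum_val e).1 then 1
                 else if k == (enum_val e).2 then -1 else 0.

(* The diagonal entries of S2 are the nonzero singular values of C, in an
   arbitrary order. *)
Record incidenceSVD (R : realType) n E (C : 'M[R]_(E, n.+1)) :=
  IncidenceSVD {
  svdU : 'M[R]_E;
  svdS : 'M[R]_(E, n.+1);
  svdV : 'M[R]_n.+1;
  svdS2 : 'M[R]_n;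
  svdV2 : 'M[R]_(n.+1, n);
  svdU_orth : orthogonalMx svdU;
  svdV_orth : orthogonalMx svdV;
  svd_eq : C = svdU *m svdS *m svdV^T;
  svdV_eq : svdV = castmx (erefl, addn1 n)
    (row_mx svdV2 (const_mx (Num.sqrt n.+1%:R)^-1 : 'cV[R]_n.+1));
  svd_leE : (n <= E)%N;
  svdS_eq : svdS = castmx (subnKC svd_leE, addn1 n)
    (block_mx svdS2 0 0 (0 : 'M[R]_(E - n, 1)));
  svdS2_diag : is_diag_mx svdS2;
  svdS2_gt0 : forall i, 0 < svdS2 i i }.

(** ** The error recursion of the N = n.+1 agents *)

Lemma dimH N M : (\sum_(k < N) M = N * M)%N.
Proof. by rewrite sum_nat_const card_ord. Qed.

Lemma dimR' n M : (n * M + M + n * M = \sum_(i < (2 * n.+1).-1) M)%N.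
Proof. by rewrite dimH -mulSnr -mulnDl mul2n -addnn addnS. Qed.

Definition matH (R : realType) N M (Ru : 'I_N -> 'M[R]_M) : 'M[R]_(N * M) :=
  castmx (dimH N M, dimH N M) (\mxdiag_(k < N) Ru k).

Definition calV0 (R : realType) N M : 'M[R]_(N * M, M) :=
  castmx (erefl, mul1n M)
    ((const_mx (Num.sqrt N%:R)^-1 : 'cV[R]_N) *t (1%:M : 'M[R]_M)).

Section Recursion.
Variables (R : realType) (n M : nat) (Ru : 'I_n.+1 -> 'M[R]_M).
Variables (E : nat) (C : 'M[R]_(E, n.+1)) (D : incidenceSVD C).

Definition calS2 : 'M[R]_(n * M) := svdS2 D *t (1%:M : 'M[R]_M).
Definition calV2 : 'M[R]_(n.+1 * M, n * M) := svdV2 D *t (1%:M : 'M[R]_M).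

Definition matR' (eta : R) : 'M[R]_(\sum_(i < (2 * n.+1).-1) M) :=
  let H := matH Ru in let V0 := calV0 R n.+1 M in
  castmx (dimR' n M, dimR' n M)
    (block_mx
       (block_mx
          (calV2^T *m H *m calV2 + eta *: (calS2^T *m calS2)) (calV2^T *m H *m V0)
          (V0^T *m H *m calV2)              (n.+1%:R^-1 *: \sum_(k < n.+1) Ru k))
       (col_mx calS2^T 0)
       (row_mx (- calS2) 0)
       0).

Definition matB' (eta mu : R) : 'M[R]_(\sum_(i < (2 * n.+1).-1) M) :=
  1%:M - mu *: matR' eta.

Definition matF' (eta mu : R) := tracySingh (matB' eta mu)^T (matB' eta mu)^T.

End Recursion.

(* Main.v *)
(* If R' z = lambda z with z = (x, y) complex, x collecting the two primal blocks
   and W the (symmetric) primal diagonal block of R', the off-diagonal blocks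
   cancel in the energy identity  x^* W x = Re(lambda) |z|^2.
   For every eta > 0 the block W is positive definite: a null vector (x2, x0)
   satisfies S2 x2 = 0, hence x2 = 0, and then x0^T (sum_k R_{u,k}) x0 = 0.  And
   x = 0 forces S2^T y = 0, so y = 0.  Thus Re(lambda) > 0, so etabar = 0 works,
   and the finitely many eigenvalues 1 - mu lambda of B' lie in the open unit
   disc for mu small.  Finally, the eigenvalues of a Tracy-Singh product are
   products of eigenvalues of the factors, because v |-> v (A (x)_b B) is
   X |-> A^T X B up to reindexing, a product of two commuting maps. *)
Require Import Defs.
From mathcomp Require Import ring lra.

Set Implicit Arguments.
Unset Strict Implicit.
Unset Printing Implicit Defensive.

Import Order.TTheory GRing.Theory Num.Theory.
Local Open Scope ring_scope.

(* The unqualified Re and Im are the R[i]-valued ones of numClosedFieldType. *)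
Local Notation Re := complex.Re.
Local Notation Im := complex.Im.

(** * Finite complex spectra and eigenvalues of commuting maps *)

Lemma eigenvalue_seq (C : closedFieldType) n (A : 'M[C]_n) :
  exists s : seq C, forall z, eigenvalue A z = (z \in s).
Proof.
have [s charE] := closed_field_poly_normal (char_poly A).
exists s => z; rewrite eigenvalue_root_char charE rootZ ?root_prod_XsubC //.
by rewrite lead_coef_eq0 monic_neq0 ?char_poly_monic.
Qed.

(** The spectrum is finite, so the supremum is at most a maximum over the list [s] and strictness
    survives. [0 < r] settles the empty spectrum, where [sup] defaults to 0. *)
Lemma spectralRadius_lt (R : realType) m (A : 'M[R]_m) (r : R) : 0 < r ->
  (forall z, eigenvalue (map_mx (real_complex R) A) z -> Normc.normc z < r) ->
  spectralRadius A < r.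
Proof.
move=> r_gt0 ltAr; rewrite /spectralRadius.
set Ac := map_mx _ A; set S := (X in sup X).
have [s eigP] := eigenvalue_seq Ac.
have [S0 | /classical_sets.set0P S_neq0] := eqVneq S classical_sets.set0.
  by rewrite S0 sup0.
apply: (@le_lt_trans _ _ (\big[Num.max/0]_(z <- s) Normc.normc z)).
  apply: ge_sup => // _ [z zA ->].
  by apply: le_bigmax_seq; rewrite -?eigP.
rewrite big_seq; apply: bigmax_lt => // z zs.
by apply: ltAr; rewrite eigP.
Qed.

(** The restrictions of [A] and [B] to the invariant subspace [V] still commute, hence share an
    eigenvector, which [row_base V] carries back. *)
Lemma common_eigenvector_stable (C : numClosedFieldType) m n
    (V : 'M[C]_(m, n)) (A B : 'M[C]_n) :
    V != 0 -> A *m B = B *m A -> stablemx V A -> stablemx V B ->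
  exists2 v : 'rV_n, v != 0 & [&& (v <= V)%MS, stablemx v A & stablemx v B].
Proof.
move=> V_neq0 AB VA VB.
have VA' : stablemx (row_base V) A by rewrite stablemx_row_base.
have VB' : stablemx (row_base V) B by rewrite stablemx_row_base.
have [||v v_neq0 /andP[vA vB]] :=
    @spectral.common_eigenvector2 _ _ (restrictmx V A) (restrictmx V B).
- by rewrite lt0n mxrank_eq0.
- by rewrite -!conjmxM ?inE // AB.
exists (v *m row_base V).
  by rewrite mulmx_free_eq0 // row_base_free.
apply/and3P; split; [| exact: stablemx_comp VA' vA | exact: stablemx_comp VB' vB].
by rewrite (submx_trans (submxMl _ _)) // eq_row_base.
Qed.

(** Left multiplication by [A^T] and right multiplication by [B] commute, so both preserve the
    [z]-eigenspace of their composite. A common eigenvector [Y] there satisfies [A^T Y = a Y] and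
    [Y B = b Y], whence [z = a b]. *)
Lemma eigenvalue_mul2 (C : numClosedFieldType) m n (A : 'M[C]_m) (B : 'M[C]_n)
    (X : 'M[C]_(m, n)) (z : C) :
    X != 0 -> A^T *m X *m B = z *: X ->
  exists a b, [/\ eigenvalue A a, eigenvalue B b & z = a * b].
Proof.
move=> X_neq0 AXB.
pose f := lin_mulmx A^T : 'M_(m * n); pose g := lin_mulmxr B : 'M_(m * n).
have fg : f *m g = g *m f.
  apply/row_matrixP => i; rewrite !rowE !mulmxA.
  by rewrite !mul_rV_lin /= !mxvecK mulmxA.
have fgE Y : mxvec Y *m (f *m g) = mxvec (A^T *m Y *m B).
  by rewrite mulmxA !mul_vec_lin.
have stableE h : h *m (f *m g) = f *m g *m h -> stablemx (eigenspace (f *m g) z) h.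
  move=> hfg; apply/eigenspaceP; rewrite -mulmxA hfg mulmxA.
  by have /eigenspaceP -> := submx_refl (eigenspace (f *m g) z); rewrite scalemxAl.
have XE : eigenspace (f *m g) z != 0.
  apply: contraNneq X_neq0 => V0; rewrite -mxvec_eq0 -submx0 -V0.
  by apply/eigenspaceP; rewrite fgE AXB linearZ.
have [||v v_neq0 /and3P[vV /eigenvectorP[a va] /eigenvectorP[b vb]]] :=
  common_eigenvector_stable XE fg.
- by apply: stableE; rewrite -!mulmxA -fg.
- by apply: stableE; rewrite mulmxA fg.
pose Y := vec_mx v; have Y_neq0 : Y != 0 by rewrite vec_mx_eq0.
have vE : v = mxvec Y by rewrite vec_mxK.
have AY : A^T *m Y = a *: Y.
  move/eigenspaceP: va; rewrite vE mul_vec_lin /= -linearZ.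
  exact: (can_inj mxvecK).
have YB : Y *m B = b *: Y.
  move/eigenspaceP: vb; rewrite vE mul_vec_lin /= -linearZ.
  exact: (can_inj mxvecK).
exists a, b; split.
(* [eigenvalue] refers to row vectors: a nonzero column of [Y], transposed, serves for [A], and a
   nonzero row for [B]. *)
- have /matrix0Pn [i [j Yij]] := Y_neq0.
  apply/eigenvalueP; exists (row j Y^T).
    by rewrite -row_mul -[A]trmxK -trmx_mul AY !linearZ.
  by apply: contraNneq Yij => /rowP/(_ i); rewrite !mxE => ->.
- have /matrix0Pn [i [j Yij]] := Y_neq0.
  apply/eigenvalueP; exists (row i Y); first by rewrite -row_mul YB linearZ.
  by apply: contraNneq Yij => /rowP/(_ j); rewrite !mxE => ->.
have : A^T *m Y *m B = z *: Y.
  move/eigenspaceP: vV; rewrite vE fgE -linearZ.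
  exact: (can_inj mxvecK).
move/eqP; rewrite eq_sym AY -scalemxAl YB scalerA -subr_eq0.
by rewrite -scalerBl scaler_eq0 (negPf Y_neq0) orbF subr_eq0 => /eqP.
Qed.

(** * Tracy-Singh products as two-sided matrix multiplication *)

Section TracySinghEigen.
Variables (K : comNzRingType) (M p q : nat).

Definition tens_vec_mx m n (u : 'rV[K]_(m * n)) : 'M[K]_(m, n) :=
  \matrix_(a, b) u 0 (mxtens_index (a, b)).

Lemma tens_vec_mxM m n r s (u : 'rV[K]_(m * n)) (P : 'M_(m, r)) (Q : 'M_(n, s)) :
  tens_vec_mx (u *m (P *t Q)) = P^T *m tens_vec_mx u *m Q.
Proof.
apply/matrixP => c d; rewrite !mxE.
under [RHS]eq_bigr do rewrite !mxE mulr_suml.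
rewrite exchange_big pair_big /=.
rewrite (reindex (@mxtens_index m n)) /=; last first.
  by exists (@mxtens_unindex m n) => ? _; rewrite (mxtens_indexK, mxtens_unindexK).
apply: eq_bigr => -[a b] _; rewrite tensmxE !mxE /=.
by rewrite mulrA [P _ _ * _]mulrC.
Qed.

(** The reshaping follows the nested block partition, so that multiplying by a Tracy-Singh product
    becomes [X |-> A^T X B]. *)
Definition block_vec_mx (v : 'rV[K]_(\sum_(i < p) \sum_(k < q) (M * M))) :
    'M[K]_(\sum_(i < p) M, \sum_(k < q) M) :=
  \mxblock_(i, k) tens_vec_mx (submxrow (submxrow v i) k).

Lemma block_vec_mxZ z v : block_vec_mx (z *: v) = z *: block_vec_mx v.
Proof.
by apply/matrixP => a b; rewrite !mxE.
Qed.

Lemma block_vec_mx_eq0 v : block_vec_mx v = 0 -> v = 0.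
Proof.
move=> v0; apply/mxrowP => i; apply/mxrowP => k.
rewrite !submxrow0; apply/rowP => c.
have /matrixP/(_ (mxtens_unindex c).1 (mxtens_unindex c).2) :
    submxblock (block_vec_mx v) i k = 0 by rewrite v0; apply/matrixP => a b; rewrite !mxE.
by rewrite mxblockK [LHS]mxE -surjective_pairing mxtens_unindexK => ->; rewrite !mxE.
Qed.

(** Block [(j, l)] of either side is a double sum over [i] and [k], which leaves the Kronecker
    identity [tens_vec_mxM] for each pair of blocks. *)
Lemma block_vec_mxM v (A : 'M[K]_(\sum_(i < p) M)) (B : 'M[K]_(\sum_(k < q) M)) :
  block_vec_mx (v *m \mxblock_(i < p, j < p) \mxblock_(k < q, l < q)
                       (submxblock A i j *t submxblock B k l)) =
  A^T *m block_vec_mx v *m B.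
Proof.
have mul_mxblock_row r (d : nat) (w : 'rV[K]_(\sum_(i < r) d))
    (F : 'I_r -> 'I_r -> 'M[K]_d) :
    w *m \mxblock_(i, j) F i j = \mxrow_j (\sum_i (submxrow w i *m F i j)).
  by rewrite -mul_mxrow_mxblock submxrowK.
rewrite mul_mxblock_row -{2}[A]submxblockK tr_mxblock -{2}[B]submxblockK !mul_mxblock.
apply/eq_mxblock => j l; rewrite mxrowK.
under [X in submxrow X _]eq_bigr => i _ do rewrite mul_mxblock_row.
rewrite -mxrow_sum mxrowK.
under [RHS]eq_bigr => k _ do rewrite mulmx_suml.
rewrite exchange_big /=.
have tens_sum (I : finType) (F : I -> 'rV[K]_(M * M)) :
    tens_vec_mx (\sum_i F i) = \sum_i tens_vec_mx (F i).
  apply/matrixP => a b; rewrite mxE !summxE.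
  by apply: eq_bigr => i _; rewrite mxE.
rewrite tens_sum; apply: eq_bigr => i _.
rewrite tens_sum; apply: eq_bigr => k _.
exact: tens_vec_mxM.
Qed.

End TracySinghEigen.

Lemma tracySingh_eigenvalue (R : realType) M p q
    (A : 'M[R]_(\sum_(i < p) M)) (B : 'M[R]_(\sum_(k < q) M)) (z : R[i]) :
    eigenvalue (map_mx (real_complex R) (tracySingh A B)) z ->
  exists a b, [/\ eigenvalue (map_mx (real_complex R) A) a,
                  eigenvalue (map_mx (real_complex R) B) b & z = a * b].
Proof.
move=> /eigenvalueP[v vz v_neq0].
apply: (@eigenvalue_mul2 _ _ _ _ _ (block_vec_mx v)).
  by apply: contraNneq v_neq0 => /block_vec_mx_eq0 ->.
rewrite -block_vec_mxM -block_vec_mxZ -vz; congr (block_vec_mx (_ *m _)).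
by apply/matrixP => i j; rewrite !mxE rmorphM.
Qed.

(** * Small step-sizes, and real forms of complex eigenvectors *)

Lemma normc_lt1 (R : rcfType) (z : R[i]) :
  Re z ^+ 2 + Im z ^+ 2 < 1 -> Normc.normc z < 1.
Proof.
case: z => a b /= lt1; rewrite -[ltRHS]sqrtr1 ltr_sqrt //.
Qed.

Lemma pos_lower_bound (R : realDomainType) (T : eqType) (s : seq T) (f : T -> R) :
    {in s, forall x, 0 < f x} ->
  exists2 m, 0 < m & {in s, forall x, m <= f x}.
Proof.
elim: s => [_|x s IHs fs]; first by exists 1.
have [y ys|m m_gt0 m_le] := IHs; first by apply: fs; rewrite inE ys orbT.
exists (Num.min (f x) m); first by rewrite lt_min m_gt0 fs ?mem_head.
move=> y; rewrite inE ge_min => /predU1P[->|/m_le ->]; first by rewrite lexx.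
by rewrite orbT.
Qed.

(** For [l = a + i b] with [a > 0], and [mu > 0], the number [|1 - mu l|^2 = 1 - 2 mu a + mu^2 (a^2
    + b^2)] is below 1 exactly when [mu < 2 a / (a^2 + b^2)]; [mubar] is a positive lower bound of
    these thresholds over the spectrum. *)
Lemma eigenvalue_one_sub_lt1 (R : realType) m (A : 'M[R]_m) :
    (forall z, eigenvalue (map_mx (real_complex R) A) z -> 0 < Re z) ->
  exists2 mubar : R, 0 < mubar & forall mu, 0 < mu -> mu < mubar ->
    forall z, eigenvalue (map_mx (real_complex R) (1%:M - mu *: A)) z ->
      Normc.normc z < 1.
Proof.
move=> ReA_gt0; set Ac := map_mx _ A in ReA_gt0.
have [s eigP] := eigenvalue_seq Ac.
pose bound (z : R[i]) : R := 2 * Re z / (Re z ^+ 2 + Im z ^+ 2).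
have [|mubar mubar_gt0 mubar_le] := @pos_lower_bound _ _ s bound.
  move=> z; rewrite -eigP => /ReA_gt0 Rez; rewrite /bound divr_gt0 ?mulr_gt0 //.
  by rewrite ltr_wpDr ?sqr_ge0 ?exprn_gt0.
exists mubar; first exact: mubar_gt0.
move=> mu mu_gt0 mu_lt z /eigenvalueP[v vz v_neq0].
pose l := (1 - z) / (mu%:C)%C.
have muC_neq0 : (mu%:C)%C != 0 :> R[i] by rewrite fmorph_eq0 gt_eqF.
have zE : z = 1 - (mu%:C)%C * l by rewrite /l mulrC divfK // subKr.
have lA : eigenvalue Ac l.
  apply/eigenvalueP; exists v => //; apply: (scalerI muC_neq0).
  rewrite scalerA /l [_ * (_ / _)]mulrC divfK // scalerBl scale1r -vz.
  rewrite map_mxB map_scalar_mx rmorph1 map_mxZ mulmxBr mulmx1 -scalemxAr.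
  by rewrite subKr.
have := ReA_gt0 _ lA; move: lA; rewrite eigP => ls.
have : mu < bound l by apply: lt_le_trans mu_lt (mubar_le _ ls).
rewrite {}zE /bound; case: l {ls} => a b mu_ab a_gt0; apply: normc_lt1.
move: mu_ab a_gt0; simpc => /= mu_ab a_gt0.
have ab_gt0 : 0 < a ^+ 2 + b ^+ 2 by rewrite ltr_wpDr ?sqr_ge0 ?exprn_gt0.
have : mu * (mu * (a ^+ 2 + b ^+ 2)) < mu * (2 * a).
  by rewrite ltr_pM2l // -ltr_pdivlMr.
by lra.
Qed.

(** A left eigenvector of [A^T] is a right eigenvector of [A]; [x] and [y] are its real and
    imaginary parts. *)
Lemma real_eigenvector (R : realType) m (A : 'M[R]_m) (z : R[i]) :
    eigenvalue (map_mx (real_complex R) A^T) z ->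
  exists x y : 'cV[R]_m, [/\ (x != 0) || (y != 0),
    A *m x = Re z *: x - Im z *: y & A *m y = Im z *: x + Re z *: y].
Proof.
move=> /eigenvalueP[v vz v_neq0].
pose x : 'cV_m := \col_i Re (v 0 i); pose y : 'cV_m := \col_i Im (v 0 i).
have vE i : v 0 i = (Re (v 0 i) +i* Im (v 0 i))%C by case: (v 0 i).
have sumE (I : finType) (F : I -> R[i]) :
    \sum_i F i = ((\sum_i Re (F i)) +i* (\sum_i Im (F i)))%C.
  by apply: (big_rec3 (fun u a b => u = (a +i* b)%C)) => // i [a b] c d _ ->; case: (F i).
have AE i : ((A *m x) i 0 +i* (A *m y) i 0)%C = z * v 0 i.
  move/rowP/(_ i): vz; rewrite !mxE sumE => <-; congr (_ +i* _)%C;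
    by apply: eq_bigr => j _; rewrite !mxE vE; simpc; rewrite /= mulrC.
exists x, y; split.
- apply: contraNT v_neq0; rewrite negb_or !negbK => /andP[/eqP x0 /eqP y0].
  apply/eqP/rowP => i; rewrite vE.
  have /colP/(_ i) := x0; have /colP/(_ i) := y0.
  by rewrite !mxE => -> ->.
- apply/colP => i; move: (AE i); rewrite vE => AEi.
  have /(congr1 (@Re R)) := AEi; rewrite /= => ->.
  by case: z {vz AE AEi} => a b; simpc; rewrite !mxE.
- apply/colP => i; move: (AE i); rewrite vE => AEi.
  have /(congr1 (@Im R)) := AEi; rewrite /= => ->.
  by case: z {vz AE AEi} => a b; simpc; rewrite !mxE addrC.
Qed.

(** * Inner products and the energy identity *)

Definition dotmx (R : comPzRingType) m (x y : 'cV[R]_m) : R := (x^T *m y) 0 0.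

Lemma dotmxE (R : comPzRingType) m (x y : 'cV[R]_m) :
  dotmx x y = \sum_i x i 0 * y i 0.
Proof. by rewrite /dotmx mxE; apply: eq_bigr => i _; rewrite mxE. Qed.

Lemma dotmxC (R : comPzRingType) m (x y : 'cV[R]_m) : dotmx x y = dotmx y x.
Proof. by rewrite !dotmxE; apply: eq_bigr => i _; rewrite mulrC. Qed.

Lemma dotmxDr (R : comPzRingType) m (x y z : 'cV[R]_m) :
  dotmx x (y + z) = dotmx x y + dotmx x z.
Proof. by rewrite /dotmx mulmxDr mxE. Qed.

Lemma dotmxNr (R : comPzRingType) m (x y : 'cV[R]_m) :
  dotmx x (- y) = - dotmx x y.
Proof. by rewrite /dotmx mulmxN mxE. Qed.

Lemma dotmxZr (R : comPzRingType) m a (x y : 'cV[R]_m) :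
  dotmx x (a *: y) = a * dotmx x y.
Proof. by rewrite /dotmx -scalemxAr mxE. Qed.

Lemma dotmxMr (R : comPzRingType) m n (A : 'M[R]_(m, n)) x y :
  dotmx x (A *m y) = dotmx (A^T *m x) y.
Proof. by rewrite /dotmx trmx_mul trmxK mulmxA. Qed.

Lemma dotmx_ge0 (R : realDomainType) m (x : 'cV[R]_m) : 0 <= dotmx x x.
Proof. by rewrite dotmxE sumr_ge0 // => i _; rewrite -expr2 sqr_ge0. Qed.

Lemma dotmx_eq0 (R : realDomainType) m (x : 'cV[R]_m) :
  (dotmx x x == 0) = (x == 0).
Proof.
apply/eqP/eqP => [|->]; last by rewrite /dotmx mulmx0 mxE.
rewrite dotmxE => /eqP; rewrite psumr_eq0; last first.
  by move=> i _; rewrite -expr2 sqr_ge0.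
move=> /allP x0; apply/colP => i; rewrite mxE.
by have := x0 i (mem_index_enum i); rewrite /= -expr2 sqrf_eq0 => /eqP.
Qed.

Lemma saddle_eigenvalue_gt0 (R : realType) p q
    (W : 'M[R]_p) (S : 'M[R]_(p, q)) (z : R[i]) :
    (forall x : 'cV_p, x != 0 -> 0 < dotmx x (W *m x)) ->
    (forall y : 'cV_q, S *m y = 0 -> y = 0) ->
    eigenvalue (map_mx (real_complex R) (block_mx W S (- S^T) 0)^T) z ->
  0 < Re z.
Proof.
move=> W_gt0 S_inj /real_eigenvector[x [y []]].
rewrite -[x]vsubmxK -[y]vsubmxK; move: (Re z) (Im z) => a b.
move: (usubmx x) (dsubmx x) (usubmx y) (dsubmx y) => {x y} x1 x2 y1 y2.
rewrite !mul_block_col !scale_col_mx !opp_col_mx !add_col_mx !mul0mx !addr0.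
move=> xy_neq0 /eq_col_mx[Ex1 Ex2] /eq_col_mx[Ey1 Ey2].
(* The coupling terms [u^T S v] and [v^T S^T u] cancel. *)
have dotE u v (s : 'cV_p) (t : 'cV_q) : W *m u + S *m v = s -> - S^T *m u = t ->
    dotmx u (W *m u) = dotmx u s + dotmx v t.
  move=> <- <-; rewrite mulNmx dotmxDr dotmxNr !dotmxMr trmxK.
  by rewrite [dotmx (S *m v) u]dotmxC dotmxMr addrK.
(* Adding the identities for the real and imaginary parts also cancels the terms in [b]. *)
have energy : dotmx x1 (W *m x1) + dotmx y1 (W *m y1) =
    a * (dotmx x1 x1 + dotmx x2 x2 + dotmx y1 y1 + dotmx y2 y2).
  rewrite (dotE _ _ _ _ Ex1 Ex2) (dotE _ _ _ _ Ey1 Ey2).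
  rewrite !dotmxDr !dotmxNr !dotmxZr (dotmxC y1 x1) (dotmxC y2 x2).
  by ring.
have norm_ge0 : 0 <= dotmx x1 x1 + dotmx x2 x2 + dotmx y1 y1 + dotmx y2 y2.
  by rewrite !addr_ge0 ?dotmx_ge0.
have W_ge0 u : 0 <= dotmx u (W *m u).
  by have [->|/W_gt0/ltW //] := eqVneq u 0; rewrite mulmx0 /dotmx mulmx0 mxE.
have pos : 0 < dotmx x1 (W *m x1) + dotmx y1 (W *m y1) -> 0 < a.
  rewrite energy => aN_gt0; rewrite ltNge; apply/negP => a_le0.
  by have := mulr_le0_ge0 a_le0 norm_ge0; rewrite leNgt aN_gt0.
have [x10|/W_gt0 ?] := eqVneq x1 0; last by rewrite pos // ltr_pwDl.
have [y10|/W_gt0 ?] := eqVneq y1 0; last by rewrite pos // ltr_wpDl.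
(* Without a primal part, the first block row leaves [S x2 = 0] and [S y2 = 0], so the whole
   eigenvector would vanish. *)
rewrite x10 y10 mulmx0 !scaler0 subrr !add0r in Ex1 Ey1.
by rewrite x10 y10 (S_inj _ Ex1) (S_inj _ Ey1) !col_mx0 eqxx in xy_neq0.
Qed.

(** * Kronecker lifts and the block-diagonal covariance matrix *)

Lemma tensmx1_unit (F : fieldType) n M (A : 'M[F]_n) :
  (0 < M)%N -> A \in unitmx -> A *t (1%:M : 'M_M) \in unitmx.
Proof.
(* Size 0, the case of a single agent, is separate because [tensmx_unit] concerns nonzero sizes. *)
move=> M_gt0; case: n A => [|n] A uA.
  by rewrite unitmxE det_mx00 unitr1.
by rewrite tensmx_unit ?unitmx1 // -lt0n.
Qed.

Section Agents.
Variables (R : realType) (N M : nat).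

(** This is the Kronecker product of the unit row [e_k^T] with [I_M]. *)
Definition agentProj (k : 'I_N) : 'M[R]_(M, N * M) :=
  \matrix_(a, j) (mxtens_index (k, a) == j)%:R.

Lemma agentProj_mul p k (X : 'M[R]_(N * M, p)) a c :
  (agentProj k *m X) a c = X (mxtens_index (k, a)) c.
Proof.
rewrite mxE (bigD1 (mxtens_index (k, a))) //= mxE eqxx mul1r big1 ?addr0 //.
by move=> j; rewrite mxE eq_sym => /negPf ->; rewrite mul0r.
Qed.

(** This form splits quadratic expressions in [matH Ru] into sums over the agents. *)
Lemma matH_sum (Ru : 'I_N -> 'M[R]_M) :
  matH Ru = \sum_k (agentProj k)^T *m Ru k *m agentProj k.
Proof.
(* Both numberings put the pair [(k, a)] at position [k * M + a]. *)
have castE k a : cast_ord (esym (dimH N M)) (mxtens_index (k, a)) =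
    @tagnat.Rank N (fun=> M) k a.
  apply: val_inj; rewrite [RHS]tagnat.RankEsum /=.
  by rewrite (big_ord_narrow (ltnW (ltn_ord k))) sum_nat_const card_ord.
apply/matrixP => i j.
case: (mxtens_indexP i) => k a; case: (mxtens_indexP j) => l b.
rewrite castmxE /= !castE summxE.
transitivity (if k == l then Ru k a b else 0).
  transitivity (submxblock (\mxdiag_k Ru k) k l a b); first by rewrite [RHS]mxE.
  rewrite mxblockK; case: eqP => [_|_]; last by rewrite mxE.
  by rewrite conform_mx_id.
have entry m : ((agentProj m)^T *m Ru m *m agentProj m)
    (mxtens_index (k, a)) (mxtens_index (l, b)) =
    if (m == k) && (m == l) then Ru m a b else 0.
  have PE c s d : agentProj m c (mxtens_index (s, d)) = ((m == s) && (c == d))%:R.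
    by rewrite mxE (can_eq (@mxtens_indexK _ _)).
  rewrite mxE (bigD1 b) //= PE eqxx andbT big1 ?addr0; last first.
    by move=> d /negPf db; rewrite PE db andbF mulr0.
  rewrite mxE (bigD1 a) //= mxE PE eqxx andbT big1 ?addr0; last first.
    by move=> c /negPf ca; rewrite mxE PE ca andbF mul0r.
  by do 2!case: eqP => _; rewrite ?(mul0r, mul1r, mulr0, mulr1).
under eq_bigr do rewrite entry.
rewrite -big_mkcond /=.
case: eqVneq => [<-|kl].
  by under eq_bigl do rewrite andbb; rewrite big_pred1_eq.
by rewrite big_pred0 // => m; apply: contraNF kl => /andP[/eqP <- /eqP <-].
Qed.

Lemma agentProj_calV0 k :
  agentProj k *m calV0 R N M = ((Num.sqrt N%:R)^-1)%:M.
Proof.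
apply/matrixP => a c; rewrite agentProj_mul castmxE /=.
have -> : cast_ord (esym (mul1n M)) c = mxtens_index (0, c) by apply: val_inj.
by rewrite cast_ord_id tensmxE !mxE mulr_natr.
Qed.

(** Each agent enters with weight [(1 / sqrt N)^2]. The averaged covariance in [matR'] is thus the
    [V0]-compression of [H], like its three neighbouring blocks. *)
Lemma calV0_matH (Ru : 'I_N -> 'M[R]_M) :
  (calV0 R N M)^T *m matH Ru *m calV0 R N M = N%:R^-1 *: \sum_k Ru k.
Proof.
rewrite matH_sum mulmx_sumr mulmx_suml scaler_sumr; apply: eq_bigr => k _.
rewrite !mulmxA -mulmxA -trmx_mul !agentProj_calV0.
rewrite tr_scalar_mx mul_mx_scalar mul_scalar_mx scalerA -invfM -expr2.
by rewrite sqr_sqrtr ?ler0n.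
Qed.

Lemma matH_ge0 (Ru : 'I_N -> 'M[R]_M) (x : 'cV_(N * M)) :
  (forall k, posSemidefMx (Ru k)) -> 0 <= dotmx x (matH Ru *m x).
Proof.
move=> Ru_psd; rewrite matH_sum mulmx_suml /dotmx mulmx_sumr summxE.
apply: sumr_ge0 => k _; have [_ /(_ (agentProj k *m x))] := Ru_psd k.
by rewrite trmx_mul !mulmxA.
Qed.

End Agents.

(** * Positivity of the primal block and the spectrum of [matR'] *)

Section ErrorRecursion.
Variables (R : realType) (n M E : nat) (C : 'M[R]_(E, n.+1)) (D : incidenceSVD C).
Variable Ru : 'I_n.+1 -> 'M[R]_M.
Hypotheses (M_gt0 : (0 < M)%N) (Ru_psd : forall k, posSemidefMx (Ru k))
  (sumRu_pd : posDefMx (\sum_(k < n.+1) Ru k)).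

Lemma calS2_unit : calS2 M D \in unitmx.
Proof.
apply: tensmx1_unit => //; have /is_diag_mxP S2_diag := svdS2_diag D.
have -> : svdS2 D = diag_mx (\row_i svdS2 D i i).
  apply/matrixP => i j; rewrite !mxE; case: eqVneq => [->|ij] //.
  by rewrite S2_diag.
rewrite unitmxE det_diag unitfE; apply/prodf_neq0 => i _.
by rewrite mxE gt_eqF // svdS2_gt0.
Qed.

(** With [w = V2 x2 + V0 x0] the form is [w^T H w + eta |S2 x2|^2], a sum of nonnegative terms. The
    second is positive if [x2] is nonzero; otherwise the first is the averaged covariance form at
    [x0]. *)
Lemma primal_block_gt0 (eta : R) (x : 'cV_(n * M + M)) : 0 < eta -> x != 0 ->
  0 < dotmx x (block_mx
    ((calV2 M D)^T *m matH Ru *m calV2 M D + eta *: ((calS2 M D)^T *m calS2 M D))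
    ((calV2 M D)^T *m matH Ru *m calV0 R n.+1 M)
    ((calV0 R n.+1 M)^T *m matH Ru *m calV2 M D)
    (n.+1%:R^-1 *: \sum_(k < n.+1) Ru k) *m x).
Proof.
move=> eta_gt0; rewrite -calV0_matH -[x]vsubmxK.
move: (usubmx x) (dsubmx x) => {x} x2 x0 x_neq0.
set V2 := calV2 M D; set V0 := calV0 R n.+1 M; set S2 := calS2 M D.
set H := matH Ru; set w := V2 *m x2 + V0 *m x0.
have -> : dotmx (col_mx x2 x0) (block_mx (V2^T *m H *m V2 + eta *: (S2^T *m S2))
      (V2^T *m H *m V0) (V0^T *m H *m V2) (V0^T *m H *m V0) *m col_mx x2 x0) =
    dotmx w (H *m w) + eta * dotmx (S2 *m x2) (S2 *m x2).
  rewrite mul_block_col {1}/dotmx tr_col_mx mul_row_col mxE.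
  rewrite mulmxDl -scalemxAl addrAC -!mulmxA -!mulmxDr -/w.
  rewrite -[LHS]/(dotmx x2 _ + dotmx x0 _) dotmxDr dotmxZr.
  rewrite (dotmxMr V2^T) (dotmxMr V0^T) (dotmxMr S2^T) !trmxK.
  rewrite addrAC; congr (_ + _).
  by rewrite [RHS]dotmxC [in RHS]/w dotmxDr !(dotmxC (H *m _)).
have H_ge0 := matH_ge0 w Ru_psd.
have [x20|x2_neq0] := eqVneq x2 0; last first.
  rewrite ltr_wpDl // mulr_gt0 // lt_neqAle dotmx_ge0 andbT eq_sym dotmx_eq0.
  apply: contraNneq x2_neq0 => /(congr1 (mulmx (invmx S2))).
  by rewrite mulKmx ?calS2_unit // mulmx0 => ->.
have x0_neq0 : x0 != 0.
  by apply: contraNneq x_neq0 => ->; rewrite x20 col_mx0.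
rewrite /w x20 !mulmx0 add0r [dotmx 0 0]/dotmx mulmx0 mxE mulr0 addr0.
rewrite dotmxC dotmxMr dotmxC !mulmxA calV0_matH -scalemxAl dotmxZr.
rewrite mulr_gt0 ?invr_gt0 ?ltr0n // /dotmx mulmxA.
by have [_] := sumRu_pd; apply.
Qed.

Lemma matR'_eigenvalue_gt0 (eta : R) (z : R[i]) : 0 < eta ->
  eigenvalue (map_mx (real_complex R) (matR' Ru D eta)^T) z -> 0 < Re z.
Proof.
move=> eta_gt0; rewrite /matR'; case: _ / (dimR' n M); rewrite castmx_id.
set W := block_mx (_ + _) _ _ _.
(* This exhibits the saddle shape with [S = col_mx S2^T 0], injective because [S2] is invertible. *)
have -> : row_mx (- calS2 M D) (0 : 'M_(n * M, M)) =
    - (col_mx (calS2 M D)^T (0 : 'M_(M, n * M)))^T.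
  by rewrite tr_col_mx trmxK trmx0 opp_row_mx oppr0.
apply: saddle_eigenvalue_gt0 => [x|y].
  exact: primal_block_gt0.
rewrite mul_col_mx mul0mx -[RHS]col_mx0 => /eq_col_mx[+ _].
move=> /(congr1 (mulmx (invmx (calS2 M D)^T))).
by rewrite mulKmx ?unitmx_tr ?calS2_unit // mulmx0.
Qed.

End ErrorRecursion.

Theorem theorem3 (R : realType) (n M : nat) (M_gt0 : (0 < M)%N)
    (adj : rel 'I_n.+1) (adj_sym : symmetric adj) (adj_irr : irreflexive adj)
    (adj_conn : connectedGraph adj)
    (D : incidenceSVD (incidence R adj))
    (Ru : 'I_n.+1 -> 'M[R]_M)
    (Ru_psd : forall k, posSemidefMx (Ru k))
    (sumRu_pd : posDefMx (\sum_(k < n.+1) Ru k)) :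
  exists etabar : R, forall eta : R, 0 <= eta -> etabar < eta ->
    exists2 mubar : R, 0 < mubar &
      forall mu : R, 0 < mu -> mu < mubar ->
        spectralRadius (matF' Ru D eta mu) < 1.
Proof.
exists 0 => eta _ eta_gt0.
(* The transpose appears because both factors of [matF'] are [1 - mu R'^T]. *)
have [z|mubar mubar_gt0 B_lt1] := @eigenvalue_one_sub_lt1 R _ (matR' Ru D eta)^T.
  exact: matR'_eigenvalue_gt0.
exists mubar; first exact: mubar_gt0.
move=> mu mu_gt0 mu_lt; apply: spectralRadius_lt => [|z]; first exact: ltr01.
have BE : (matB' Ru D eta mu)^T = 1%:M - mu *: (matR' Ru D eta)^T.
  by rewrite linearB /= trmx1 linearZ.
move=> /tracySingh_eigenvalue[a [b []]]; rewrite BE.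
move=> /(B_lt1 _ mu_gt0 mu_lt) a_lt1 /(B_lt1 _ mu_gt0 mu_lt) b_lt1 ->.
have normc_ge0 (w : R[i]) : 0 <= Normc.normc w by case: w => *; exact: sqrtr_ge0.
by rewrite Normc.normcM mulr_ilt1.
Qed.
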